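(* Let $(X,d)$ be a non-empty complete metric space and let $\Phi:X\multimap X$ be a contracting compact-valued multi-function with $\lambda=\operatorname{Lip}(\Phi)<1$. Then: (1) the set $\operatorname{Fix}(\Phi)$ of fixed points of $\Phi$ is compact and not empty; (2) if $\Phi$ is finite-valued, then the set $\operatorname{Fix}(\Phi)$ is finite; (3) the fixed fractal $\mathcal F(\Phi)=\overline{\Phi^\omega(\operatorname{Fix}(\Phi))}$ is compact and not empty; (4) $\Phi(\mathcal F(\Phi))=\mathcal F(\Phi)$; (5) $d_H\big(\mathcal F(\Phi),\Phi^n(B)\big)\le \frac{\lambda^n}{1-\lambda}\,d_H(\Phi(B),B)$ for every $n\in\omega$ and every non-empty compact subset $B\subset X$.
   Context: $\omega=\{0,1,2,\dots\}$. A multi-valued function (multi-function) $\Phi:X\multimap X$ is any subset $\Phi\subset X\times X$; for $A\subset X$, $\Phi(A)=\{y\in X:\exists x\in A,\ (x,y)\in\Phi\}$ and $\Phi(x)=\Phi(\{x\})$. Iterates: $\Phi^0(A)=A$, $\Phi^{n+1}(A)=\Phi(\Phi^n(A))$. The orbit of $A$ is $\Phi^\omega(A)=\bigcup_{n\in\omega}\Phi^n(A)$. $\operatorname{Fix}(\Phi)=\{x\in X:x\in\Phi(x)\}$. The fixed fractal of $\Phi$ is the closure $\mathcal F(\Phi)=\overline{\Phi^\omega(\operatorname{Fix}(\Phi))}$ in $X$. $\Phi$ is compact-valued (resp. finite-valued) if for each $x\in X$ the set $\Phi(x)$ is compact (resp. finite) and not empty. For non-empty $A,B\subset X$ the Hausdorff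 distance is $d_H(A,B)=\max\{\sup_{a\in A}d(a,B),\sup_{b\in B}d(b,A)\}\in[0,\infty]$, where $d(a,B)=\inf_{b\in B}d(a,b)$; also $d_H(\emptyset,\emptyset)=0$ and $d_H(A,\emptyset)=d_H(\emptyset,A)=\infty$ for non-empty $A$. The Lipschitz constant is $\operatorname{Lip}(\Phi)=\sup_{x\neq y}\frac{d_H(\Phi(x),\Phi(y))}{d(x,y)}$ (equal to $0$ if $X$ is a single point); $\Phi$ is contracting if $\operatorname{Lip}(\Phi)<1$. Convention: $0^0=1$. *)

(* Defs.v *)
From HB Require Import structures.
From mathcomp Require Import all_boot all_order all_algebra.
From mathcomp Require Import all_classical all_reals all_analysis.

Set Implicit Arguments.
Unset Strict Implicit.
Unset Printing Implicit Defensive.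

Import Order.TTheory GRing.Theory Num.Theory.

Local Open Scope classical_set_scope.
Local Open Scope ring_scope.

(* Non-emptiness is part of this structure, as a [completeType] is pointed. *)
#[short(type="completeMetricType")]
HB.structure Definition CompleteMetric (K : numDomainType) :=
  { M of Metric K M & CompletePseudoMetric K M }.

Section multifunction.
Context {X : Type}.
Implicit Types (Phi : set (X * X)) (A : set X).

Definition mimage Phi A : set X := [set y | exists2 x, A x & Phi (x, y)].

Definition mvalue Phi (x : X) : set X := mimage Phi [set x].

Definition miter Phi (n : nat) A : set X := iter n (mimage Phi) A.

Definition morbit Phi A : set X := \bigcup_n miter Phi n A.

Definition mfix Phi : set X := [set x | mvalue Phi x x].

Definition finite_valued Phi : Prop :=
  forall x, finite_set (mvalue Phi x) /\ mvalue Phi x !=set0.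

End multifunction.

Section topological.
Context {X : topologicalType}.
Implicit Types Phi : set (X * X).

Definition fixed_fractal Phi : set X := closure (morbit Phi (mfix Phi)).

Definition compact_valued Phi : Prop :=
  forall x, compact (mvalue Phi x) /\ mvalue Phi x !=set0.

End topological.

Section metric.
Context {R : realType} {X : metricType R}.
Implicit Types (A B : set X) (Phi : set (X * X)).
Local Open Scope ereal_scope.

Definition point_dist (a : X) B : \bar R := ereal_inf [set (mdist a b)%:E | b in B].

Definition hausdorff_dist A B : \bar R :=
  if A == set0 then (if B == set0 then 0 else +oo)
  else if B == set0 then +oo
  else maxe (ereal_sup [set point_dist a B | a in A])
            (ereal_sup [set point_dist b A | b in B]).

(* The supremum of the empty set is -oo in [\bar R], whence the separate case. *)
Definition lip Phi : \bar R :=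
  if `[< forall x y : X, x = y >] then 0
  else ereal_sup
    [set hausdorff_dist (mvalue Phi p.1) (mvalue Phi p.2)
         * ((mdist p.1 p.2)^-1)%:E | p in [set p : X * X | p.1 <> p.2]].

Definition contracting Phi : Prop := lip Phi < 1.

Lemma point_dist_ge0 a B : 0 <= point_dist a B.
Proof. by apply: le_ereal_inf_tmp => _ [b _ <-]; rewrite lee_fin mdist_ge0. Qed.

Lemma hausdorff_dist_ge0 A B : 0 <= hausdorff_dist A B.
Proof.
rewrite /hausdorff_dist; case: eqP => [_|/eqP/set0P[a Aa]]; first by case: ifP.
case: ifP => // _; rewrite le_max; apply/orP; left.
by apply: le_trans (point_dist_ge0 a B) _; apply: ereal_sup_ubound; exists a.
Qed.

Lemma lip_ge0 Phi : 0 <= lip Phi.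
Proof.
rewrite /lip; case: asboolP => // nX.
have [x [y xy]] : exists x y : X, x <> y.
  by apply: contra_notP nX => + x y => /forallNP/(_ x)/forallNP/(_ y)/contrapT.
apply: (@le_trans _ _ (hausdorff_dist (mvalue Phi x) (mvalue Phi y)
         * ((mdist x y)^-1)%:E)); last by apply: ereal_sup_ubound; exists (x, y).
by rewrite mule_ge0 ?hausdorff_dist_ge0// lee_fin invr_ge0 mdist_ge0.
Qed.

(* [fine (lip Phi)] is thus the Lipschitz constant of a contracting [Phi]. *)
Lemma contracting_lip_fin_num Phi : contracting Phi -> lip Phi \is a fin_num.
Proof.
by move=> lip1; rewrite ge0_fin_numE ?lip_ge0// (lt_le_trans lip1) ?leey.
Qed.

End metric.

(* Main.v *)
Require Import Defs.
From mathcomp Require Import all_boot all_order all_algebra.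
From mathcomp Require Import finmap.
From mathcomp Require Import all_classical all_reals all_analysis.
From mathcomp Require Import lra.

Set Implicit Arguments.
Unset Strict Implicit.
Unset Printing Implicit Defensive.

Import Order.TTheory GRing.Theory Num.Theory.
Import numFieldNormedType.Exports.
Local Open Scope classical_set_scope.
Local Open Scope ring_scope.

(** Let [l < 1] be the Lipschitz constant of [Phi], [P A] the image of a set [A]
    under [Phi], and say that [A] is [r]-near [B] when every point of [A] is at
    distance at most [r] from some point of [B]. As the values of [Phi] are
    compact, distances to them are attained, so if [y] is a value at [x] then
    some value at [x'] is at distance at most [l * d(x, x')] from [y]
    ([contracting_selection]); hence [P] turns [r]-near sets into [l * r]-near
    ones ([nearby_mimage]).

    Compactness comes from one remark ([bounded_totally_bounded]): a bounded set
    [E] contained in [[set x0] `|` P E] is totally bounded. A finite net of [E]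
    at scale [s] is mapped by [P] to a finite union of compact sets, a finite
    net of which is, up to an arbitrarily small error, a net of [E] at scale
    [l * s]; iterating makes the scale arbitrarily small. If the values at [x0]
    lie within [r * (1 - l)] of [x0], then the ball of radius [r] around [x0]
    is invariant and contains all fixed points, so the remark applies both to
    the orbit of [x0] and to the orbit of the set of fixed points, the latter
    being equal to its own image.

    The orbit of [x0] contains points [x] having a value [y] with [d(x, y)]
    arbitrarily small. These points accumulate in the compact closure of the
    orbit, and the limit is a fixed point since the graph of [Phi] is closed
    ([mfix_nonempty]). The closure [F] of the orbit of the fixed points is
    compact, it contains the closed set of fixed points, and [P F = F] since [P]
    maps compact sets to closed sets. If the values are finite, every fixed
    point [x] is isolated among fixed points: for a fixed point [y] close to
    [x], a value at [x] within [l * d(x, y)] of [y] can only be [x] itself,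
    which forces [y = x] ([finite_mfix]).

    Finally let [D] be the Hausdorff distance between [F] and [B], and [h] the
    one between [P B] and [B]. From [F = P F] one gets [D <= l * D + h], that
    is [D <= h / (1 - l)], and applying [P] to [F] and [B] [n] times multiplies
    the bound by [l ^+ n] ([hausdorff_dist_fixed_fractal]). *)

(** * Small powers and ultrafilters *)

Lemma exprn_mul_small (R : realType) (r l e : R) : 0 <= l -> l < 1 -> 0 < e ->
  exists n, l ^+ n * r <= e.
Proof.
move=> l0 l1 e0.
have : geometric r l @ \oo --> (0 : R) by apply: cvg_geometric; rewrite ger0_norm.
move=> /cvgrPdist_lt/(_ _ e0)[N _ /(_ N (leqnn _))] /=.
rewrite sub0r normrN mulrC => h; exists N.
by rewrite (le_trans (ler_norm _))// ltW.
Qed.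

(** One of finitely many sets belongs to an ultrafilter as soon as their union
    does. *)
Lemma ultra_bigcup (I : choiceType) T (F : set_system T) (S : set I)
    (f : I -> set T) :
  UltraFilter F -> finite_set S -> F (\bigcup_(x in S) f x) ->
  exists2 x, S x & F (f x).
Proof.
move=> FU fS FSf; apply: contrapT => nF.
have FC x : S x -> F (~` f x).
  move=> Sx; have [Ffx|//] := in_ultra_setVsetC (f x) FU.
  by exfalso; apply: nF; exists x.
have /finite_fsetP[D SD] := fS.
have : F (\bigcap_(x in [set` D]) ~` f x).
  by apply: filter_bigI => x xD; apply: FC; rewrite SD.
rewrite -SD => FI.
by have [t [[x Sx fxt] /(_ x Sx)]] := filter_ex (filterI FSf FI).
Qed.

(** * Distances to compact sets, nearness and the Hausdorff distance *)

Section metric_facts.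
Context {R : realType} {X : metricType R}.
Implicit Types (A B C K S : set X) (r s e : R) (x y : X).

Lemma mdist_continuous x : continuous (mdist x).
Proof.
move=> y; apply/cvgrPdist_lt => e e0; near=> z.
have yz : mdist y z < e.
  near: z.
  exact: (@metricType_numDomainType.cvgr_dist_lt _ X _ (nbhs y) _ id y _ e).
have := metric_triangle x y z; have := metric_triangle x z y.
rewrite (metric_sym z y) => h1 h2.
by rewrite ltr_norml; apply/andP; split; lra.
Unshelve. all: by end_near. Qed.

Lemma compact_nearest K x : compact K -> K !=set0 ->
  exists2 y, K y & forall z, K z -> mdist x y <= mdist x z.
Proof.
move=> cK K0.
have [] := @compact_EVT_min X R (mdist x) K K0 cK.
  by apply: continuous_subspaceT; exact: mdist_continuous.
move=> y; rewrite inE => Ky h; exists y => // z Kz; apply: h.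
by rewrite inE.
Qed.

Lemma compact_mdist_bounded K x : compact K -> K !=set0 ->
  exists2 r, 0 <= r & forall z, K z -> mdist x z <= r.
Proof.
move=> cK K0.
have [] := @compact_EVT_max X R (mdist x) K K0 cK.
  by apply: continuous_subspaceT; exact: mdist_continuous.
move=> y; rewrite inE => Ky h; exists (mdist x y); first exact: mdist_ge0.
by move=> z Kz; apply: h; rewrite inE.
Qed.

Lemma closure_mdistP A x :
  closure A x <-> forall e, 0 < e -> exists2 y, A y & mdist x y <= e.
Proof.
split=> [clA e e0|h B].
  have /clA [y [Ay]] : nbhs x (ball x e) by exact: nbhsx_ballx.
  by rewrite ballEmdist/= => /ltW xy; exists y.
move=> /nbhs_ballP[e /= e0 xeB].
have [|y Ay xy] := h (e / 2); first by rewrite divr_gt0.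
exists y; split => //; apply: xeB; rewrite ballEmdist/=.
by rewrite (le_lt_trans xy)// ltr_pdivrMr// ltr_pMr// ltr1n.
Qed.

Lemma compact_metric_closed K : compact K -> closed K.
Proof. by apply: compact_closed; exact: metric_hausdorff. Qed.

(** [A] lies in the closed [r]-thickening of [B]: a one-sided, attained form of
    the bound [r] on the Hausdorff distance. *)
Definition nearby r A B := forall a, A a -> exists2 b, B b & mdist a b <= r.

Lemma nearby_trans r s A B C : nearby r A B -> nearby s B C ->
  nearby (r + s) A C.
Proof.
move=> AB BC a /AB[b /BC[c Cc bc] ab]; exists c => //.
by rewrite (le_trans (metric_triangle a b c))// lerD.
Qed.

Lemma le_nearby r s A B : r <= s -> nearby r A B -> nearby s A B.
Proof. by move=> rs AB a /AB[b Bb ab]; exists b => //; exact: le_trans ab rs. Qed.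

Lemma compact_nearby A B : compact A -> A !=set0 -> B !=set0 ->
  exists2 r, 0 <= r & nearby r A B.
Proof.
move=> cA A0 [b Bb]; have [r r0 h] := compact_mdist_bounded b cA A0.
by exists r => // a Aa; exists b => //; rewrite metric_sym; exact: h.
Qed.

Lemma point_dist_leP x K r : compact K -> K !=set0 ->
  (point_dist x K <= r%:E)%E <-> exists2 y, K y & mdist x y <= r.
Proof.
move=> cK K0; split=> [xKr|[y Ky xyr]].
  have [y Ky ymin] := compact_nearest x cK K0; exists y => //.
  rewrite -lee_fin; apply: le_trans xKr.
  by apply: le_ereal_inf_tmp => _ [z Kz <-]; rewrite lee_fin; exact: ymin.
apply: (@le_trans _ _ (mdist x y)%:E); last by rewrite lee_fin.
by apply: ereal_inf_lbound; exists y.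
Qed.

Lemma hausdorff_dist_leP A B r : compact A -> A !=set0 -> compact B ->
  B !=set0 ->
  (hausdorff_dist A B <= r%:E)%E <-> nearby r A B /\ nearby r B A.
Proof.
move=> cA A0 cB B0; rewrite /hausdorff_dist.
have /set0P/negbTE -> := A0; have /set0P/negbTE -> := B0.
rewrite ge_max; split=> [/andP[AB BA]|[AB BA]].
  split=> [a Aa|b Bb].
    apply/point_dist_leP => //; apply: le_trans AB.
    by apply: ereal_sup_ubound; exists a.
  apply/point_dist_leP => //; apply: le_trans BA.
  by apply: ereal_sup_ubound; exists b.
apply/andP; split; apply: ge_ereal_sup => _ [a Aa <-]; apply/point_dist_leP => //.
  exact: AB.
exact: BA.
Qed.

Lemma compact_hausdorff_dist A B : compact A -> A !=set0 -> compact B ->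
  B !=set0 -> exists r, hausdorff_dist A B = r%:E.
Proof.
move=> cA A0 cB B0.
have [r r0 AB] := compact_nearby cA A0 B0.
have [s s0 BA] := compact_nearby cB B0 A0.
have : (hausdorff_dist A B <= (r + s)%:E)%E.
  apply/hausdorff_dist_leP => //; split; [move: AB|move: BA].
    by apply: le_nearby; rewrite lerDl.
  by apply: le_nearby; rewrite lerDr.
have := hausdorff_dist_ge0 A B.
by case: (hausdorff_dist A B) => // t _ _; exists t.
Qed.

(** Every positive scale admits a finite net, not necessarily inside [A]. *)
Definition totally_bounded A :=
  forall e, 0 < e -> exists2 S, finite_set S & nearby e A S.

Lemma totally_bounded_closure A : totally_bounded A ->
  totally_bounded (closure A).
Proof.
move=> tA e e0; have [|S fS AS] := tA (e / 2); first by rewrite divr_gt0.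
exists S => //; rewrite [e in nearby e _ _]splitr; apply: nearby_trans AS.
by move=> x /closure_mdistP; apply; rewrite divr_gt0.
Qed.

(** If arbitrarily good approximate solutions exist in a compact set, they
    accumulate at some point of it. Cluster points of the filter generated by
    the sets [K `&` Q e] make a choice of sequences unnecessary. *)
Lemma compact_approx K (Q : R -> set X) : compact K ->
  (forall r s, r <= s -> Q r `<=` Q s) ->
  (forall e, 0 < e -> exists2 x, K x & Q e x) ->
  exists2 p, K p & forall e, 0 < e -> exists2 x, Q e x & mdist p x <= e.
Proof.
move=> cK Qle KQ.
pose F : set_system X := filter_from [set e : R | 0 < e] (fun e => K `&` Q e).
have PF : ProperFilter F.
  apply: filter_from_proper; last by move=> e /= /KQ[x Kx Qx]; exists x.
  apply: filter_from_filter; first by exists 1 => /=.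
  move=> r s /= r0 s0; exists (Num.min r s); first by rewrite /= lt_min r0 s0.
  move=> x [Kx Qx]; split; split=> //; apply: Qle Qx; first by rewrite ge_min lexx.
  by rewrite ge_min lexx orbT.
have [|p [Kp clp]] := cK F PF.
  by exists 1 => //= x [].
exists p => // e e0.
have [||x [[Kx Qx]]] := clp (K `&` Q e) (ball p e).
- by exists e.
- exact: nbhsx_ballx.
by rewrite ballEmdist/= => /ltW px; exists x.
Qed.

End metric_facts.

(** * Compactness in complete metric spaces *)

Section complete_metric_facts.
Context {R : realType} {X : completeMetricType R}.
Implicit Types (A K : set X) (e : R) (x y : X).

Lemma compact_totally_bounded K : compact K -> totally_bounded K.
Proof.
rewrite compact_cover => cK e e0.
have [|x Kx|S _ KS] := cK X setT (fun x => (ball x e)°).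
- by move=> x _; exact: open_interior.
- by exists x => //; exact: nbhsx_ballx.
exists [set` S]; first exact: finite_fset.
move=> x /KS[y Sy /interior_subset]; rewrite ballEmdist/= => xy.
by exists y => //; rewrite metric_sym ltW.
Qed.

Lemma totally_bounded_compact A : totally_bounded A -> closed A -> compact A.
Proof.
move=> tA clA; rewrite compact_ultra => F FU FA.
have /cauchy_cvgP : cauchy F.
  apply: cauchy_exP => e e0.
  have [|S fS AS] := tA (e / 2); first by rewrite divr_gt0.
  have [|x _ Fx] := @ultra_bigcup X _ F S (fun x => ball x e) FU fS; last first.
    by exists x.
  apply: filterS FA => x /AS[y Sy xy]; exists y => //.
  by rewrite ballEmdist/= metric_sym (le_lt_trans xy)// ltr_pdivrMr// ltr_pMr// ltr1n.
move=> /cvg_ex[/= p Fp]; exists p; split => //; apply: clA => B /Fp FB.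
by apply: (@filter_ex _ F); exact: filterI.
Qed.

Lemma compact_isolated_finite K : compact K ->
  (forall x, K x -> exists2 e, 0 < e &
     forall y, K y -> mdist x y < e -> y = x) -> finite_set K.
Proof.
move=> cK iK.
have {iK}iK x : exists e, K x -> 0 < e /\ forall y, K y -> mdist x y < e -> y = x.
  have [/iK[e e0 h]|nKx] := pselect (K x); first by exists e.
  by exists 0 => /nKx.
have [d dP] := choice iK.
move: (cK); rewrite compact_cover => /(_ X K (fun x => (ball x (d x))°))[].
- by move=> x _; exact: open_interior.
- move=> x Kx; exists x => //; apply: nbhsx_ballx; exact: (dP x Kx).1.
move=> S SK KS; apply: (@sub_finite_set _ _ [set` S]); last exact: finite_fset.
move=> x Kx; have [y /= Sy /interior_subset] := KS x Kx.
rewrite ballEmdist/= => yx; have Ky : K y by have := SK _ Sy; rewrite inE.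
by rewrite ((dP y Ky).2 x Kx yx).
Qed.

End complete_metric_facts.

(** * Contracting compact-valued multi-functions *)

Section contraction.
Context {R : realType} {X : completeMetricType R}.
Implicit Types (A B E K : set X) (r e : R) (x y : X).
Variables (Phi : set (X * X)) (l : R).

Lemma mvalueE x y : mvalue Phi x y = Phi (x, y).
Proof.
by apply/propext; split=> [[_ /= ->]|Phixy] //; exists x.
Qed.

Lemma mimageS A B : A `<=` B -> mimage Phi A `<=` mimage Phi B.
Proof. by move=> AB y [x Ax xy]; exists x => //; exact: AB. Qed.

Hypotheses (Phi_compact : compact_valued Phi) (l0 : 0 <= l) (l1 : l < 1).
(** This is the consequence of the Lipschitz property on which all of the
    section rests; no Hausdorff distance occurs before its last lemma. *)
Hypothesis Phi_lip : forall x x' y, Phi (x, y) ->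
  exists2 y', Phi (x', y') & mdist y y' <= l * mdist x x'.

Let l_neq1 : 1 - l != 0. Proof. by rewrite subr_eq0 gt_eqF. Qed.
Let l1_gt0 : 0 < 1 - l. Proof. by rewrite subr_gt0. Qed.

(** The graph of [Phi] is closed, with closure stated through distances. *)
Lemma mgraph_closed x y :
  (forall e, 0 < e ->
     exists z w, [/\ Phi (z, w), mdist x z <= e & mdist y w <= e]) ->
  Phi (x, y).
Proof.
move=> h; rewrite -mvalueE; have [cPx _] := Phi_compact x.
apply: (compact_metric_closed cPx); apply/closure_mdistP => e e0.
have [|z [w [zw xz yw]]] := h (e / 2); first by rewrite divr_gt0.
have [v xv wv] := Phi_lip x zw; exists v; first by rewrite mvalueE.
rewrite (splitr e) (le_trans (metric_triangle y w v))// lerD//.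
by rewrite (le_trans wv)// metric_sym (le_trans _ xz)// ler_piMl ?mdist_ge0// ltW.
Qed.

Lemma closed_mfix : closed (mfix Phi).
Proof.
move=> x /closure_mdistP clx; rewrite /mfix/= mvalueE.
apply: mgraph_closed => e /clx[z]; rewrite /mfix/= mvalueE => zz xz.
by exists z, z.
Qed.

Lemma mimage_nonempty A : A !=set0 -> mimage Phi A !=set0.
Proof.
by move=> [a Aa]; have [_ [y]] := Phi_compact a; rewrite mvalueE; exists y, a.
Qed.

Lemma closed_mimage K : compact K -> closed (mimage Phi K).
Proof.
move=> cK y /closure_mdistP cly.
have [|e e0|x Kx xy] := compact_approx
    (Q := fun e => [set x | exists2 w, Phi (x, w) & mdist y w <= e]) cK.
- by move=> r s rs x [w xw yw]; exists w => //; exact: le_trans yw rs.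
- by have [w [x Kx xw] yw] := cly e e0; exists x => //; exists w.
exists x => //; apply: mgraph_closed => e /xy[z [w zw yw] xz].
by exists z, w.
Qed.

Lemma nearby_mimage r A B :
  nearby r A B -> nearby (l * r) (mimage Phi A) (mimage Phi B).
Proof.
move=> AB y [a /AB[b Bb ab] ay]; have [y' by' yy'] := Phi_lip b ay.
exists y'; first by exists b.
by rewrite (le_trans yy')// ler_wpM2l.
Qed.

Lemma nearby_miter n r A B :
  nearby r A B -> nearby (l ^+ n * r) (miter Phi n A) (miter Phi n B).
Proof.
move=> AB; elim: n => [|n IH]; first by rewrite expr0 mul1r.
by rewrite exprS -mulrA; exact: nearby_mimage.
Qed.

Lemma totally_bounded_mimage_finite S :
  finite_set S -> totally_bounded (mimage Phi S).
Proof.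
move=> fS e e0.
have /choice[N NP] x : exists N : set X,
    finite_set N /\ nearby e (mvalue Phi x) N.
  have [cPx _] := Phi_compact x.
  by have [N fN nN] := compact_totally_bounded cPx e0; exists N.
exists (\bigcup_(x in S) N x).
  by apply: bigcup_finite => // x _; exact: (NP x).1.
move=> y [x Sx]; rewrite -mvalueE => /(NP x).2[z Nz yz].
by exists z => //; exists x.
Qed.

Lemma totally_bounded_mimage A :
  totally_bounded A -> totally_bounded (mimage Phi A).
Proof.
move=> tA e e0; have e20 : 0 < e / 2 by rewrite divr_gt0.
have [S fS /nearby_mimage AS] := tA _ e20.
have [T fT ST] := totally_bounded_mimage_finite fS e20.
exists T => //; apply: le_nearby (nearby_trans AS ST).
by rewrite [leRHS]splitr lerD2r ler_piMl// ltW.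
Qed.

Lemma compact_mimage K : compact K -> compact (mimage Phi K).
Proof.
move=> cK; apply: totally_bounded_compact; last exact: closed_mimage.
exact/totally_bounded_mimage/compact_totally_bounded.
Qed.

Lemma compact_miter n K : compact K -> compact (miter Phi n K).
Proof. by move=> cK; elim: n => //= n; exact: compact_mimage. Qed.

Lemma miter_nonempty n A : A !=set0 -> miter Phi n A !=set0.
Proof. by move=> A0; elim: n => //= n; exact: mimage_nonempty. Qed.

(** A net of [E] at scale [s] yields one at scale about [l * s], by adjoining
    [x0] to a net of its image. Adjoining [x0] is what makes the lemma apply to
    the orbit of [x0], which need not be contained in its own image. *)
Lemma bounded_totally_bounded x0 r E : 0 <= r -> nearby r E [set x0] ->
  E `<=` x0 |` mimage Phi E -> totally_bounded E.
Proof.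
move=> r0 Ex0 EPE.
(* The error [d] is stable under the step, as [l * d + (1 - l) * d = d]. *)
have net n d : 0 < d -> exists2 S, finite_set S & nearby (l ^+ n * r + d) E S.
  move=> d0; elim: n => [|n [S fS ES]].
    exists [set x0]; first exact: finite_set1.
    by apply: le_nearby Ex0; rewrite expr0 mul1r lerDl ltW.
  have [|T fT ST] := @totally_bounded_mimage_finite S fS ((1 - l) * d).
    by rewrite mulr_gt0.
  exists (x0 |` T); first by rewrite finite_setU; split => //; exact: finite_set1.
  have {ST}h := nearby_trans (nearby_mimage ES) ST.
  move=> x /EPE[->|/h[y Ty xy]].
    exists x0; first by left.
    by rewrite mdistxx addr_ge0 ?(ltW d0)// mulr_ge0// exprn_ge0.
  exists y; first by right.
  by rewrite (le_trans xy)// exprS; lra.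
move=> e e0; have e20 : 0 < e / 2 by rewrite divr_gt0.
have [n ln] := exprn_mul_small r l0 l1 e20.
have [S fS ES] := net n _ e20.
exists S => //; apply: le_nearby ES.
by rewrite [leRHS]splitr lerD2r.
Qed.

(** The radius [r] is that of an invariant ball around [x0], see [nearby_morbit];
    it also bounds the distance from [x0] to the fixed points, see
    [nearby_mfix]. *)
Lemma nearby_point_value x0 : exists2 r, 0 <= r &
  nearby (r * (1 - l)) (mvalue Phi x0) [set x0].
Proof.
have [cP P0] := Phi_compact x0; have [r r0 h] := compact_mdist_bounded x0 cP P0.
exists (r / (1 - l)); first by rewrite divr_ge0// ltW.
rewrite divfK// => y /h yr; exists x0 => //.
by rewrite metric_sym.
Qed.

Lemma nearby_morbit x0 r A : nearby (r * (1 - l)) (mvalue Phi x0) [set x0] ->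
  nearby r A [set x0] -> nearby r (morbit Phi A) [set x0].
Proof.
move=> x0r Ax0 x [n _]; elim: n x => //= n IH.
apply: le_nearby (nearby_trans (nearby_mimage IH) x0r).
by lra.
Qed.

Lemma nearby_mfix x0 r : nearby (r * (1 - l)) (mvalue Phi x0) [set x0] ->
  nearby r (mfix Phi) [set x0].
Proof.
move=> x0r x; rewrite /mfix/= mvalueE => xx.
have [y x0y xy] := Phi_lip x0 xx.
have [|_ -> yx0] := x0r y; first by rewrite mvalueE.
exists x0 => //; rewrite -(ler_pM2r l1_gt0).
have := metric_triangle x y x0; lra.
Qed.

Lemma mimage_morbit A : mimage Phi (morbit Phi A) `<=` morbit Phi A.
Proof. by move=> y [x [n _ nx] xy]; exists n.+1 => //; exists x. Qed.

Lemma subset_morbit A : A `<=` morbit Phi A.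
Proof. by move=> x Ax; exists 0%N. Qed.

Lemma morbit_subset A : morbit Phi A `<=` A `|` mimage Phi (morbit Phi A).
Proof.
move=> y [[|n] _]; first by left.
by move=> [x nx xy]; right; exists x => //; exists n.
Qed.

Lemma mfix_mimage : mfix Phi `<=` mimage Phi (mfix Phi).
Proof. by move=> x xx; exists x => //; rewrite -mvalueE. Qed.

Lemma mimage_morbit_mfix :
  mimage Phi (morbit Phi (mfix Phi)) = morbit Phi (mfix Phi).
Proof.
apply/seteqP; split; first exact: mimage_morbit.
move=> x /morbit_subset[/mfix_mimage|//].
by apply: mimageS; exact: subset_morbit.
Qed.

Lemma totally_bounded_morbit_mfix : totally_bounded (morbit Phi (mfix Phi)).
Proof.
have [r r0 x0r] := nearby_point_value point.
have Er := nearby_morbit x0r (nearby_mfix x0r).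
apply: bounded_totally_bounded r0 Er _.
by rewrite mimage_morbit_mfix; exact: subsetUr.
Qed.

Lemma compact_fixed_fractal : compact (fixed_fractal Phi).
Proof.
apply: totally_bounded_compact; last exact: closed_closure.
exact/totally_bounded_closure/totally_bounded_morbit_mfix.
Qed.

Lemma mfix_fixed_fractal : mfix Phi `<=` fixed_fractal Phi.
Proof. by move=> x xx; apply: subset_closure; exact: subset_morbit. Qed.

Lemma compact_mfix : compact (mfix Phi).
Proof.
exact: subclosed_compact closed_mfix compact_fixed_fractal mfix_fixed_fractal.
Qed.

Lemma mimage_fixed_fractal : mimage Phi (fixed_fractal Phi) = fixed_fractal Phi.
Proof.
apply/seteqP; split=> [y [x /closure_mdistP clx xy]|].
  apply/closure_mdistP => e e0; have [z Ez xz] := clx e e0.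
  have [w zw yw] := Phi_lip z xy; exists w.
    by apply: mimage_morbit; exists z.
  by rewrite (le_trans yw)// (le_trans _ xz)// ler_piMl ?mdist_ge0// ltW.
rewrite [X in X `<=` _](_ : _ = closure (mimage Phi (morbit Phi (mfix Phi)))).
  apply: subset_trans (closed_mimage compact_fixed_fractal).
  by apply: closureS; apply: mimageS; exact: subset_closure.
by rewrite mimage_morbit_mfix.
Qed.

Lemma mfix_nonempty : mfix Phi !=set0.
Proof.
pose x0 : X := point; pose E := morbit Phi [set x0].
have [r r0 x0r] := nearby_point_value x0.
have cE : compact (closure E).
  apply: totally_bounded_compact; last exact: closed_closure.
  apply: totally_bounded_closure; apply: (@bounded_totally_bounded x0 r) => //.
    apply: nearby_morbit => // x ->; exists x0 => //.
    by rewrite mdistxx.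
  exact: morbit_subset.
(* Moving along values contracts the distance of a point to its successor. *)
pose s := r * (1 - l).
have almost n : exists x y, [/\ E x, Phi (x, y) & mdist x y <= l ^+ n * s].
  elim: n => [|n [x [y [Ex xy xyn]]]].
    have [_ [y x0y]] := Phi_compact x0; have [_ -> yx0] := x0r y x0y.
    exists x0, y; split; first exact: subset_morbit.
      by rewrite -mvalueE.
    by rewrite expr0 mul1r metric_sym.
  have [z yz xyz] := Phi_lip y xy; exists y, z; split => //.
    by apply: mimage_morbit; exists x.
  by rewrite (le_trans xyz)// exprS -mulrA ler_wpM2l.
have [|e e0|p _ pP] := compact_approx
    (Q := fun e => [set x | exists2 y, Phi (x, y) & mdist x y <= e]) cE.
- by move=> t u tu x [y xy xyt]; exists y => //; exact: le_trans xyt tu.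
- have [n ln] := exprn_mul_small s l0 l1 e0; have [x [y [Ex xy xyn]]] := almost n.
  exists x; first exact: subset_closure.
  by exists y => //; exact: le_trans xyn ln.
exists p; rewrite /mfix/= mvalueE; apply: mgraph_closed => e e0.
have [|x [y xy xye] px] := pP (e / 2); first by rewrite divr_gt0.
exists x, y; split => //; last first.
  by rewrite (splitr e) (le_trans (metric_triangle p x y))// lerD.
by rewrite (le_trans px)// ler_pdivrMr// ler_peMr ?ltW// ltr1n.
Qed.

Lemma finite_mfix : finite_valued Phi -> finite_set (mfix Phi).
Proof.
move=> fPhi; apply: (compact_isolated_finite compact_mfix) => x xx.
(* [d] separates [x] from the other values at [x]. *)
have [d d0 dP] : exists2 d, 0 < d &
    forall z, Phi (x, z) -> mdist x z < d -> z = x.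
  have cC : closed (mvalue Phi x `\ x).
    apply: compact_metric_closed; apply: finite_compact; apply: finite_setD.
    exact: (fPhi x).1.
  have [d d0 dP] : exists2 d, 0 < d & ball x d `<=` ~` (mvalue Phi x `\ x).
    apply/nbhs_ballP; apply: open_nbhs_nbhs; split; first exact: closed_openC.
    by move=> [_]; apply.
  exists d => // z xz zd; apply: contrapT => zx.
  by apply: (dP z); [rewrite ballEmdist|split; rewrite ?mvalueE].
exists (d / 2); first by rewrite divr_gt0.
move=> y; rewrite /mfix/= mvalueE => yy xyd.
have [z xz yz] := Phi_lip x yy.
have zx : z = x.
  apply: dP => //; rewrite (splitr d) (le_lt_trans (metric_triangle x y z))//.
  rewrite ltrD// (le_lt_trans yz)// metric_sym (le_lt_trans _ xyd)//.
  by rewrite ler_piMl ?mdist_ge0// ltW.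
move: yz; rewrite zx => yx; apply: mdist_positivity.
apply/eqP; rewrite eq_le mdist_ge0 andbT -(pmulr_rle0 _ l1_gt0); lra.
Qed.

Lemma hausdorff_dist_fixed_fractal n B : compact B -> B !=set0 ->
  (hausdorff_dist (fixed_fractal Phi) (miter Phi n B)
   <= (l ^+ n / (1 - l))%:E * hausdorff_dist (mimage Phi B) B)%E.
Proof.
move=> cB B0; set F := fixed_fractal Phi.
have cF : compact F := compact_fixed_fractal.
have F0 : F !=set0.
  by have [x xx] := mfix_nonempty; exists x; exact: mfix_fixed_fractal.
have cPB := compact_mimage cB; have PB0 := mimage_nonempty B0.
have [h hE] := compact_hausdorff_dist cPB PB0 cB B0.
have [D DE] := compact_hausdorff_dist cF F0 cB B0.
have : (hausdorff_dist (mimage Phi B) B <= h%:E)%E by rewrite hE.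
move=> /(hausdorff_dist_leP _ cPB PB0 cB B0)[PBB BPB].
have : (hausdorff_dist F B <= D%:E)%E by rewrite DE.
move=> /(hausdorff_dist_leP _ cF F0 cB B0)[FB BF].
have PF : mimage Phi F = F by exact: mimage_fixed_fractal.
(* As [D] is the distance itself, any bound [l * D + h] on it bounds [D]. *)
have Dh : D <= h / (1 - l).
  have : (hausdorff_dist F B <= (l * D + h)%:E)%E.
    apply/hausdorff_dist_leP => //; split.
      by have := nearby_trans (nearby_mimage FB) PBB; rewrite PF.
    by have := nearby_trans BPB (nearby_mimage BF); rewrite PF addrC.
  by rewrite DE lee_fin ler_pdivlMr//; lra.
have FE : miter Phi n F = F.
  by elim: n => //= n ->.
rewrite hE -EFinM; apply/hausdorff_dist_leP => //.
- exact: compact_miter.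
- exact: miter_nonempty.
have lD : l ^+ n * D <= l ^+ n / (1 - l) * h.
  by rewrite -mulrA ler_wpM2l ?exprn_ge0// mulrC.
by rewrite -{1 2}FE; split; apply: le_nearby lD _; exact: nearby_miter.
Qed.

End contraction.

(** The nearest point of [mvalue Phi x'] to [y] is suitable, as the Hausdorff
    distance bounds the distance of [y] to that compact set. *)
Lemma contracting_selection (R : realType) (X : completeMetricType R)
    (Phi : set (X * X)) : compact_valued Phi -> contracting Phi ->
  forall x x' y, Phi (x, y) -> exists2 y', Phi (x', y') &
    mdist y y' <= fine (lip Phi) * mdist x x'.
Proof.
move=> cPhi ctrPhi x x' y xy.
have [<-|/eqP xx'] := eqVneq x x'.
  by exists y => //; rewrite !mdistxx mulr0.
have dx : 0 < mdist x x' by rewrite mdist_gt0; apply/eqP.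
have : (hausdorff_dist (mvalue Phi x) (mvalue Phi x') <=
    (fine (lip Phi) * mdist x x')%:E)%E.
  rewrite EFinM fineK; last exact: contracting_lip_fin_num.
  rewrite -lee_pdivrMr// /lip; case: asboolP => [/(_ x x')//|_].
  by apply: ereal_sup_ubound; exists (x, x').
have [cx x0] := cPhi x; have [cx' x'0] := cPhi x'.
move=> /(hausdorff_dist_leP _ cx x0 cx' x'0)[+ _] => /(_ y).
by rewrite mvalueE => /(_ xy)[y']; rewrite mvalueE; exists y'.
Qed.

Theorem theorem1 (R : realType) (X : completeMetricType R) (Phi : set (X * X))
    (Phi_compact : compact_valued Phi) (Phi_contr : contracting Phi) :
  let lambda : R := fine (lip Phi) in
  [/\ compact (mfix Phi) /\ mfix Phi !=set0,
      finite_valued Phi -> finite_set (mfix Phi),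
      compact (fixed_fractal Phi) /\ fixed_fractal Phi !=set0,
      mimage Phi (fixed_fractal Phi) = fixed_fractal Phi
    & forall (n : nat) (B : set X), compact B -> B !=set0 ->
        (hausdorff_dist (fixed_fractal Phi) (miter Phi n B)
         <= (lambda ^+ n / (1 - lambda))%:E
            * hausdorff_dist (mimage Phi B) B)%E].
Proof.
move=> lambda.
have Phi_lip := contracting_selection Phi_compact Phi_contr.
have l0 : 0 <= lambda by apply: fine_ge0; exact: lip_ge0.
have l1 : lambda < 1.
  by rewrite -lte_fin fineK//; exact: contracting_lip_fin_num.
split.
- split; first exact: (compact_mfix Phi_compact l0 l1 Phi_lip).
  exact: (mfix_nonempty Phi_compact l0 l1 Phi_lip).
- exact: (finite_mfix Phi_compact l0 l1 Phi_lip).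
- split; first exact: (compact_fixed_fractal Phi_compact l0 l1 Phi_lip).
  have [x xx] := mfix_nonempty Phi_compact l0 l1 Phi_lip.
  by exists x; exact: mfix_fixed_fractal.
- exact: (mimage_fixed_fractal Phi_compact l0 l1 Phi_lip).
- by move=> n B; exact: (hausdorff_dist_fixed_fractal Phi_compact l0 l1 Phi_lip).
Qed.
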